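(* Let $N\in\mathbb{N}$, $N\geq 2$, be even and assume that $\mathcal{L}_k^{(N)}\in M_{N+1}(\mathbb{R})$ is invertible. Write $c_1$ and $c_{N+1}$ for the first and the $(N+1)$-th (last) columns of $(\mathcal{L}_k^{(N)})^{-1}$. Let $$\rho^{(1)}=\frac1{N+1}\left(\|c_1\|_{\ell^1}+1\right),\qquad \rho^{(2)}=\left\|c_{N+1}+\frac1{N+2}c_1\right\|_{\ell^1}+\frac1{N+2},$$ $$\rho^{(3)}=\frac{2}{(N+1)(N+3)}\|c_1\|_{\ell^1}+\frac1{N+1}+\frac1{N+3},$$ $$\rho_k=\frac{|\mu_k|}{2}\max\{\rho^{(1)},\rho^{(2)},\rho^{(3)}\},\qquad \beta_k=\max\left\{\|(\mathcal{L}_k^{(N)})^{-1}\|_{B(\ell^1)},\ \frac{1}{2(N+1)}\left(\|c_1\|_{\ell^1}+1\right)\right\}.$$ If $\rho_k<1$, then $\mathcal{L}_k$ is a boundedly invertible operator on $\ell^1$ with $$\|\mathcal{L}_k^{-1}\|_{B(\ell^1)}\le\frac{\beta_k}{1-\rho_k}.$$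
   Context: $\mu_k$ is a real number. $\ell^1$ is the space of real sequences $y=(y_j)_{j\ge0}$ with $\|y\|_{\ell^1}=|y_0|+2\sum_{j\ge1}|y_j|<\infty$; for finite vectors $y=(y_0,\dots,y_N)$ likewise $\|y\|_{\ell^1}=|y_0|+2\sum_{j=1}^N|y_j|$. $\|\cdot\|_{B(\ell^1)}$ is the induced operator norm (for operators on $\ell^1$, and for matrices acting on $\mathbb{R}^{N+1}$ with the finite norm). The operator $\mathcal{L}_k$ is given by $(\mathcal{L}_ky)_0=y_0+2\sum_{\ell\ge1}(-1)^\ell y_\ell$ and $(\mathcal{L}_ky)_j=\mu_ky_{j-1}+2j\,y_j-\mu_ky_{j+1}$ for $j\ge1$. $\mathcal{L}_k^{(N)}$ is the $(N+1)\times(N+1)$ upper-left truncation of the infinite matrix of $\mathcal{L}_k$ (rows and columns of indices $0,\dots,N$). ''Boundedly invertible on $\ell^1$'' means: for every $z\in\ell^1$ there is a unique $y\in\ell^1$ with $\mathcal{L}_ky=z$, and $\mathcal{L}_k^{-1}:z\mapsto y$ is bounded on $\ell^1$. *)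

(* Defs.v *)
From HB Require Import structures.
From mathcomp Require Import all_boot all_order all_algebra.
From mathcomp Require Import all_classical all_reals all_analysis.
Set Implicit Arguments.
Unset Strict Implicit.
Unset Printing Implicit Defensive.
Import Order.TTheory GRing.Theory Num.Theory.
Import numFieldNormedType.Exports.
Local Open Scope classical_set_scope.
Local Open Scope ring_scope.

Section Sequences.
Context {R : realType}.
Implicit Types (y z : nat -> R) (T : (nat -> R) -> (nat -> R)).

Definition l1norm y : \bar R :=
  (`|y 0%N|%:E + 2%:E * \sum_(1 <= j <oo) `|y j|%:E)%E.

Definition l1 : set (nat -> R) := [set y | (l1norm y < +oo)%E].

Definition l1_opnorm T : \bar R :=
  ereal_sup [set l1norm (T y) | y in [set y | (l1norm y <= 1)%E]].

(* Only used for [T] bijective from {y in l1 | T y in l1} onto l1; the value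
   [fun=> 0] is a default for the [z] without preimage. *)
Definition l1_inv T : (nat -> R) -> (nat -> R) :=
  fun z => xget (fun=> 0) [set y | l1 y /\ T y = z].

(* [T] itself may be unbounded: [T y] need not be in l1 for [y] in l1. *)
Definition boundedly_invertible T : Prop :=
  (forall z, l1 z -> exists! y, l1 y /\ T y = z) /\
  (exists C : R, forall z, l1 z -> (l1norm (l1_inv T z) <= C%:E * l1norm z)%E).

(* The series in row 0 converges absolutely for [y] in l1. *)
Definition Lop (mu : R) y : nat -> R := fun j =>
  if j is i.+1 then mu * y i + 2 * j%:R * y j - mu * y j.+1
  else y 0%N + 2 * \big[+%R/0]_(1 <= l <oo) ((-1) ^+ l * y l).

Definition unit_seq (j : nat) : nat -> R := fun l => (l == j)%:R.

(* Column [j] of the infinite matrix of an operator is the image of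
   [unit_seq j]. *)
Definition Ltrunc (mu : R) (N : nat) : 'M[R]_N.+1 :=
  \matrix_(i, j) Lop mu (unit_seq j) i.

Lemma Lop_unit_seq0 (mu : R) j :
  Lop mu (unit_seq j) 0 = if j == 0%N then 1 else 2 * (-1) ^+ j.
Proof.
rewrite /Lop.
have -> : \big[+%R/0]_(1 <= l <oo) ((-1) ^+ l * unit_seq j l) =
          if j == 0%N then 0 else (-1) ^+ j :> R.
  apply/cvg_lim => //; apply: (@cvg_near_cst _ _ _ _ \oo).
  exists j.+1 => // n /= jn.
  case: j jn => [|j] jn /=.
    rewrite big_nat big1 // => l /andP[l0 _].
    by rewrite /unit_seq gtn_eqF // mulr0.
  rewrite (big_cat_nat _ (n := j.+1)) //=; last exact: ltnW.
  rewrite big_nat big1 ?add0r; last first.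
    by move=> l /andP[_ lj]; rewrite /unit_seq ltn_eqF // mulr0.
  rewrite big_ltn // big_nat big1; last first.
    by move=> l /andP[lj _]; rewrite /unit_seq gtn_eqF // mulr0.
  by rewrite addr0 /unit_seq eqxx mulr1.
by rewrite /unit_seq; case: j => [|j] /=; rewrite ?mulr0 ?addr0 ?add0r.
Qed.

End Sequences.

Section FiniteVectors.
Context {R : realType} {N : nat}.
Implicit Types (x : 'cV[R]_N.+1) (A : 'M[R]_N.+1).

Definition vnorm x : R :=
  `|x ord0 0| + 2 * \sum_(j < N.+1 | (0 < j)%N) `|x j 0|.

Definition mx_opnorm A : R :=
  sup [set vnorm (A *m x) | x in [set x | vnorm x <= 1]].

End FiniteVectors.

Section Constants.
Context {R : realType}.
Variables (mu : R) (N : nat).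

Definition c_first : 'cV[R]_N.+1 := col ord0 (invmx (Ltrunc mu N)).
Definition c_last : 'cV[R]_N.+1 := col ord_max (invmx (Ltrunc mu N)).

Definition rho1 : R := (N.+1)%:R^-1 * (vnorm c_first + 1).

Definition rho2 : R :=
  vnorm (c_last + (N.+2)%:R^-1 *: c_first) + (N.+2)%:R^-1.

Definition rho3 : R :=
  2 / ((N.+1)%:R * (N.+3)%:R) * vnorm c_first
  + (N.+1)%:R^-1 + (N.+3)%:R^-1.

Definition rho : R := `|mu| / 2 * Num.max rho1 (Num.max rho2 rho3).

Definition beta : R :=
  Num.max (mx_opnorm (invmx (Ltrunc mu N)))
          ((2 * (N.+1)%:R)^-1 * (vnorm c_first + 1)).

End Constants.

(* Main.v *)
Require Import Defs.
From mathcomp Require Import all_boot all_order all_algebra.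
From mathcomp Require Import all_classical all_reals all_analysis.
From mathcomp Require Import ring lra zify.
Import Order.TTheory GRing.Theory Num.Theory.
Import numFieldNormedType.Exports.
Local Open Scope ring_scope.

(** Cut off the coupling between the first [N+1] unknowns and the rest.  Let
    [Lhat] be the operator that keeps the block [Ltrunc mu N], all of row 0 and,
    in the rows [j > N], only the diagonal entry [2 j].  It is block triangular
    and has the explicit inverse [A] ([approx_inv]): the tail is
    [y_j = r_j / (2 j)], and the head is obtained from the inverse of the block
    once the contribution of the tail to row 0, an alternating series, has been
    subtracted; that subtraction costs a multiple of the first column of the
    inverse.  What is left, [K = L - Lhat] ([coupling]), consists of the entries
    [mu] and [-mu] in the columns [N, N+1, ...] that were dropped.

    For [y] in l1, [L y = z] is equivalent to [y + A (K y) = A z]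
    ([Lop_fixed_point]).  Splitting [z] into head and tail gives [|A| <= beta]
    ([approx_inv_bounded]).  An operator on l1 is bounded by the largest norm of
    its columns, relative to the weights ([l1_column_bound]); the columns of
    [A K] can be computed exactly, those at [N], [N+1] and [N+2] have norms
    [|mu| rho1], [|mu| rho2] and [|mu| rho3], and the later ones are smaller than
    the one at [N+2] ([correction_column]).
    Hence [A K] is a contraction with factor [rho], the Neumann series solves
    the equation ([neumann_exists]), and [|y| <= beta |z| + rho |y|] gives both
    uniqueness and the bound [beta / (1 - rho)] ([neumann_bound]).

    The infinite sums in the norm are handled through their partial sums
    [psum], which makes every estimate a statement about finite sums of reals. *)

Set Implicit Arguments.
Unset Strict Implicit.
Unset Printing Implicit Defensive.
Local Open Scope classical_set_scope.

(** * The norm of l1 through partial sums *)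

Section L1.
Context {R : realType}.
Implicit Types (x y z b : nat -> R) (B : (nat -> R) -> (nat -> R)) (C D : R).

(** The norm of the j-th unit sequence. *)
Definition weight (j : nat) : R := if j is 0 then 1 else 2.

Definition psum (n : nat) y : R := \sum_(0 <= j < n) weight j * `|y j|.

Definition nrm y : R := fine (l1norm y).

Lemma weight_ge1 j : 1 <= weight j.
Proof. by case: j => //= ?; rewrite ler1n. Qed.

Lemma weight_gt0 j : 0 < weight j.
Proof. exact: lt_le_trans (weight_ge1 j). Qed.

Lemma psum_nd y : nondecreasing_seq (psum^~ y).
Proof.
apply/nondecreasing_seqP => n; rewrite /psum big_nat_recr //= lerDl.
by rewrite mulr_ge0 // ltW // weight_gt0.
Qed.

Lemma psum_ge0 n y : 0 <= psum n y.
Proof. by apply: sumr_ge0 => j _; rewrite mulr_ge0 // ltW // weight_gt0. Qed.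

Lemma psumS1 n y : psum n.+1 y = `|y 0| + 2 * \sum_(1 <= j < n.+1) `|y j|.
Proof.
rewrite /psum big_ltn //= mul1r mulr_sumr; congr (_ + _).
by apply: eq_big_nat => -[].
Qed.

(** The bridge from the extended-real series to real partial sums: a series of
    nonnegative terms is at most [C] as soon as its partial sums are. *)
Lemma l1norm_leP y C : (l1norm y <= C%:E)%E <-> forall n, psum n y <= C.
Proof.
have s0 : (0 <= \sum_(1 <= j <oo) `|y j|%:E)%E.
  by apply: nneseries_ge0 => n _ _; rewrite lee_fin.
split=> [yC n|yC].
  apply: le_trans (psum_nd y (leqnSn n)) _.
  rewrite -lee_fin; apply: le_trans yC; rewrite psumS1 EFinD EFinM.
  apply: leeD => //; apply: lee_wpmul2l; first by rewrite lee_fin.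
  rewrite -sumEFin; apply: nneseries_lim_ge => k _ _; by rewrite lee_fin.
have h : (\sum_(1 <= j <oo) `|y j|%:E <= ((C - `|y 0%N|) / 2)%:E)%E.
  apply: lime_le; first by apply: is_cvg_nneseries => k _ _; rewrite lee_fin.
  apply: nearW => n; rewrite sumEFin lee_fin ler_pdivlMr // mulrC lerBrDl.
  case: n => [|n]; last by rewrite -psumS1.
  by rewrite big_geq // mulr0; have := yC 1%N; rewrite psumS1 big_geq // mulr0.
apply: (@le_trans _ _ (`|y 0%N|%:E + 2%:E * ((C - `|y 0%N|) / 2)%:E)%E).
  by rewrite leeD // lee_wpmul2l // lee_fin.
by rewrite -EFinM -EFinD lee_fin; lra.
Qed.

Lemma l1norm_ge0 y : (0 <= l1norm y)%E.
Proof.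
rewrite adde_ge0 ?lee_fin // mule_ge0 ?lee_fin //.
by apply: nneseries_ge0 => n _ _; rewrite lee_fin.
Qed.

Lemma l1_nrm y : l1 y -> l1norm y = (nrm y)%:E.
Proof.
move=> ly; rewrite fineK // fin_numE; have := l1norm_ge0 y.
by move: ly; rewrite /l1 /=; case: (l1norm y).
Qed.

Lemma psum_le_nrm n y : l1 y -> psum n y <= nrm y.
Proof. by move=> ly; apply: (l1norm_leP y _).1; rewrite l1_nrm. Qed.

(** The way in which membership in l1 and norm bounds are obtained together. *)
Lemma l1_of_psum_le y C : (forall n, psum n y <= C) -> l1 y /\ nrm y <= C.
Proof.
move=> /(l1norm_leP y C) h.
have ly : l1 y by apply: le_lt_trans h _; rewrite ltry.
by split=> //; rewrite -lee_fin -l1_nrm.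
Qed.

Lemma nrm_ge0 y : 0 <= nrm y.
Proof. exact/fine_ge0/l1norm_ge0. Qed.

Lemma coord_le_nrm y j : l1 y -> `|y j| <= nrm y.
Proof.
move=> ly; apply: le_trans (psum_le_nrm j.+1 ly).
rewrite /psum big_nat_recr //= -[leLHS]add0r lerD ?psum_ge0 //.
by rewrite ler_peMl // weight_ge1.
Qed.

Lemma nrm_eq0 y : l1 y -> nrm y = 0 -> y = 0.
Proof.
move=> ly y0; apply/funext => j; apply/eqP; rewrite -normr_le0 -y0.
exact: coord_le_nrm.
Qed.

Lemma psumD n y z : psum n (y + z) <= psum n y + psum n z.
Proof.
rewrite /psum -big_split /=; apply: ler_sum => j _; rewrite -mulrDr.
by rewrite ler_wpM2l ?ler_normD // ltW // weight_gt0.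
Qed.

Lemma psumZ n a y : psum n (a *: y) = `|a| * psum n y.
Proof.
by rewrite /psum mulr_sumr; apply: eq_bigr => j _; rewrite normrM; ring.
Qed.

Lemma l1D y z : l1 y -> l1 z -> l1 (y + z) /\ nrm (y + z) <= nrm y + nrm z.
Proof.
move=> ly lz; apply: l1_of_psum_le => n; apply: le_trans (psumD _ _ _) _.
by rewrite lerD ?psum_le_nrm.
Qed.

Lemma l1Z a y : l1 y -> l1 (a *: y) /\ nrm (a *: y) <= `|a| * nrm y.
Proof.
by move=> ly; apply: l1_of_psum_le => n; rewrite psumZ ler_wpM2l ?psum_le_nrm.
Qed.

Lemma l1B y z : l1 y -> l1 z -> l1 (y - z) /\ nrm (y - z) <= nrm y + nrm z.
Proof.
move=> ly lz; apply: l1_of_psum_le => n; apply: le_trans (psumD _ _ _) _.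
by rewrite -scaleN1r psumZ normrN normr1 mul1r lerD ?psum_le_nrm.
Qed.

Lemma l1_0 : l1 (0 : nat -> R) /\ nrm 0 = 0.
Proof.
have [l0 n0] : l1 (0 : nat -> R) /\ nrm 0 <= 0.
  by apply: l1_of_psum_le => n; rewrite /psum big1 // => j _;
    rewrite normr0 mulr0.
by split=> //; apply/eqP; rewrite eq_le n0 nrm_ge0.
Qed.

Definition trunc (m : nat) y : nat -> R :=
  fun j => if (j < m)%N then y j else 0.

Lemma psum_cat n m y : (n <= m)%N ->
  psum m y = psum n y + \sum_(n <= j < m) weight j * `|y j|.
Proof. by move=> nm; rewrite /psum (big_cat_nat _ (n := n)). Qed.

(** Density of the finitely supported sequences: the norm is the supremum of the
    partial sums, so some partial sum reaches it up to [e]. *)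
Lemma trunc_approx y e : l1 y -> 0 < e ->
  exists m, l1 (y - trunc m y) /\ nrm (y - trunc m y) <= e.
Proof.
move=> ly e0.
have [m hm] : exists m, nrm y - e <= psum m y.
  apply: contrapT => /forallNP h.
  have [|_] := @l1_of_psum_le y (nrm y - e).
    by move=> n; move/negP: (h n); rewrite -ltNge => /ltW.
  lra.
exists m; apply: l1_of_psum_le => n.
apply: le_trans (psum_nd _ (leq_addl m n)) _.
rewrite (psum_cat _ (leq_addr n m)) /psum big_nat big1 ?add0r; last first.
  by move=> j /andP[_ jm]; rewrite !fctE /trunc jm subrr normr0 mulr0.
have := psum_le_nrm (m + n) ly; rewrite (psum_cat _ (leq_addr n m)) => h.
suff : \sum_(m <= j < m + n) weight j * `|(y - trunc m y) j| =
       \sum_(m <= j < m + n) weight j * `|y j| by move->; lra.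
by apply: eq_big_nat => j /andP[mj _]; rewrite !fctE /trunc ltnNge mj subr0.
Qed.

Lemma cvg_psum (u : nat -> nat -> R) y m :
  (forall j, u ^~ j @ \oo --> y j) -> psum m (u k) @[k --> \oo] --> psum m y.
Proof.
move=> uy; rewrite /psum; elim: m => [|m IH].
  under eq_fun do rewrite big_geq //.
  by rewrite big_geq //; exact: cvg_cst.
under eq_fun do rewrite big_nat_recr //=.
rewrite big_nat_recr //=; apply: cvgD => //.
by apply: cvgMl_tmp; apply: cvg_norm; exact: uy.
Qed.

(** Completeness of l1, with the rate of convergence kept.  The limit is taken
    coordinatewise; the bound [e n] survives because each partial sum of the norm
    is continuous in finitely many coordinates. *)
Lemma l1_complete (s : nat -> nat -> R) (e : nat -> R) :
  (forall n, l1 (s n)) ->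
  (forall n d, nrm (s (n + d)%N - s n) <= e n) -> e @ \oo --> 0 ->
  exists2 y, l1 y & forall n, l1 (y - s n) /\ nrm (y - s n) <= e n.
Proof.
move=> ls se e0.
have cvs j : cvgn (s ^~ j).
  apply/cauchy_cvgP/cauchy_exP => eps eps0.
  have /cvgrPdist_lt/(_ _ eps0)[n0 _ hn0] := e0.
  have := hn0 n0 (leqnn _); rewrite /= sub0r normrN => hn.
  have en : e n0 < eps by apply: le_lt_trans hn; rewrite ler_norm.
  exists (s n0 j); exists n0 => // n /= le0; rewrite /ball /= distrC.
  apply: le_lt_trans en; rewrite -(subnKC le0).
  apply: le_trans (se n0 (n - n0)%N).
  exact: (coord_le_nrm j (l1B (ls _) (ls _)).1).
pose y j := limn (s ^~ j).
have ye n : l1 (y - s n) /\ nrm (y - s n) <= e n.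
  apply: l1_of_psum_le => m.
  have cvp : psum m (s k - s n) @[k --> \oo] --> psum m (y - s n).
    apply: cvg_psum => j; apply: cvgB; [exact: cvs|exact: cvg_cst].
  apply: (cvgr_to_le cvp); exists n => // k /= nk.
  rewrite -(subnKC nk); apply: le_trans (se n (k - n)%N).
  exact: psum_le_nrm (l1B (ls _) (ls _)).1.
exists y => //.
have -> : y = (y - s 0) + s 0 by rewrite subrK.
exact: (l1D (ye 0).1 (ls 0)).1.
Qed.

End L1.

(** * Bounded operators on l1 *)

Section L1ops.
Context {R : realType}.
Implicit Types (x y z b : nat -> R) (B : (nat -> R) -> (nat -> R)) (C D : R).

Lemma l1_unit j : l1 (@unit_seq R j) /\ nrm (@unit_seq R j) = weight j.
Proof.
have pj n : psum n (@unit_seq R j) = if (j < n)%N then weight j else 0.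
  elim: n => [|n IH]; first by rewrite /psum big_geq.
  rewrite /psum big_nat_recr //= -/(psum n _) IH /unit_seq ltnS.
  case: ltngtP => [jn|jn|->];
    rewrite ?normr0 ?normr1 ?mulr0 ?mulr1 ?add0r ?addr0 //.
have [lj nj] : l1 (@unit_seq R j) /\ nrm (@unit_seq R j) <= weight j.
  by apply: l1_of_psum_le => n; rewrite pj; case: ifP => // _;
    exact/ltW/weight_gt0.
split=> //; apply/eqP; rewrite eq_le nj /=.
by have := psum_le_nrm j.+1 lj; rewrite pj ltnSn.
Qed.

(** Operators are functions on all sequences, whereas series converge only on
    l1; linearity can therefore only be asked on l1. *)
Definition l1_linear B :=
  forall a y z, l1 y -> l1 z -> B (a *: y + z) = a *: B y + B z.

Definition l1_bounded C B :=
  forall y, l1 y -> l1 (B y) /\ nrm (B y) <= C * nrm y.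

Lemma l1_linear0 B : l1_linear B -> B 0 = 0.
Proof.
move=> lB; have := lB (-1) 0 0 l1_0.1 l1_0.1.
by rewrite scaler0 addr0 scaleN1r addNr.
Qed.

Lemma l1_linearB B y z : l1_linear B -> l1 y -> l1 z -> B (y - z) = B y - B z.
Proof.
by move=> lB ly lz; rewrite addrC -scaleN1r lB // scaleN1r addrC.
Qed.

Lemma trunc0 y : trunc 0 y = 0. Proof. by []. Qed.

Lemma truncS m y : trunc m.+1 y = y m *: unit_seq m + trunc m y.
Proof.
apply/funext => j; rewrite !fctE /trunc /unit_seq ltnS /GRing.scale /=.
by case: ltngtP => [jn|jn|->]; rewrite ?mulr0 ?mulr1 ?add0r ?addr0.
Qed.

Lemma l1_trunc m y : l1 (trunc m y).
Proof.
elim: m => [|m IH]; first exact: l1_0.1.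
by rewrite truncS; exact: (l1D (l1Z _ (l1_unit m).1).1 IH).1.
Qed.

(** On finitely supported sequences the triangle inequality gives the bound; it
    extends to l1 by density, because [B] is continuous.  The constant [D] is
    a crude bound that expresses this continuity. *)
Lemma l1_column_bound B C D : l1_linear B -> l1_bounded D B ->
  (forall j, nrm (B (unit_seq j)) <= C * weight j) -> l1_bounded C B.
Proof.
move=> linB bB colB y ly; split; first exact: (bB _ ly).1.
have C0 : 0 <= C.
  by have := colB 0; rewrite /= mulr1; apply: le_trans; exact: nrm_ge0.
have trB m : nrm (B (trunc m y)) <= C * psum m y.
  elim: m => [|m IH].
    rewrite trunc0 l1_linear0 // l1_0.2 mulr_ge0 //; exact: psum_ge0.
  rewrite truncS linB; [|exact: (l1_unit m).1|exact: l1_trunc].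
  have lu := (bB _ (l1_unit m).1).1; have lt := (bB _ (l1_trunc m y)).1.
  apply: le_trans (l1D (l1Z _ lu).1 lt).2 _.
  rewrite /psum big_nat_recr //= -/(psum m y) mulrDr [leRHS]addrC lerD //.
  apply: le_trans (l1Z _ lu).2 _.
  rewrite [_ * `|y m|]mulrC mulrCA ler_wpM2l //; exact: colB.
(* [D] may be negative or zero, hence the tolerance [e / (`|D| + 1)]. *)
apply/ler_addgt0Pr => e e0.
have d0 : 0 < `|D| + 1 by rewrite ltr_wpDl.
have [m [lm nm]] := trunc_approx ly (divr_gt0 e0 d0).
have -> : B y = B (y - trunc m y) + B (trunc m y).
  by rewrite l1_linearB ?subrK //; exact: l1_trunc.
rewrite [leRHS]addrC.
apply: le_trans (l1D (bB _ lm).1 (bB _ (l1_trunc m y)).1).2 _.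
apply: lerD.
  apply: le_trans (bB _ lm).2 _;
    apply: le_trans (_ : `|D| * (e / (`|D| + 1)) <= _).
    apply: le_trans (ler_wpM2r (nrm_ge0 _) (ler_norm D)) _.
    by rewrite ler_wpM2l.
  by rewrite mulrA ler_pdivrMr // mulrC ler_pM2l // lerDl.
by apply: le_trans (trB m) _; rewrite ler_wpM2l // psum_le_nrm.
Qed.

Lemma neumann_bound B r y b : l1_bounded r B -> r < 1 -> l1 y -> y + B y = b ->
  nrm y <= nrm b / (1 - r).
Proof.
move=> bB r1 ly yb; rewrite ler_pdivlMr ?subr_gt0 //.
have [lBy nBy] := bB y ly.
have lb : l1 b by rewrite -yb; exact: (l1D ly lBy).1.
have := (l1B lb lBy).2; rewrite -{1}yb addrK => h; lra.
Qed.

(** Banach iteration [s_(n+1) = b - B s_n].  All iterates lie in the ball of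
    radius [|b| / (1 - r)], so [s_(n+d)] and [s_n] are within
    [r ^ n |b| / (1 - r)] of each other, and completeness applies. *)
Lemma neumann_exists B r b : l1_linear B -> l1_bounded r B -> 0 <= r -> r < 1 ->
  l1 b -> exists2 y, l1 y & y + B y = b.
Proof.
move=> linB bB r0 r1 lb.
have q0 : 0 < 1 - r by rewrite subr_gt0.
pose s := fix s n := if n is k.+1 then b - B (s k) else 0.
have ls n : l1 (s n).
  elim: n => [|n IH]; first exact: l1_0.1.
  exact: (l1B lb (bB _ IH).1).1.
pose e n := geometric (nrm b / (1 - r)) r n.
have se n d : nrm (s (n + d)%N - s n) <= e n.
  elim: n => [|n IH].
    rewrite /e /= expr0 mulr1 subr0 add0n; elim: d => [|d IH] /=.
      by rewrite l1_0.2 divr_ge0 ?nrm_ge0 // ltW.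
    apply: le_trans (l1B lb (bB _ (ls d)).1).2 _.
    apply: (@le_trans _ _ (nrm b + r * (nrm b / (1 - r)))).
      by rewrite lerD2l; apply: le_trans (bB _ (ls d)).2 _; rewrite ler_wpM2l.
    by rewrite le_eqVlt; apply/orP; left; apply/eqP; field; rewrite gt_eqF.
  have lB := (l1B (ls (n + d)%N) (ls n)).1.
  have -> : s (n.+1 + d)%N - s n.+1 = -1 *: B (s (n + d)%N - s n).
    rewrite (l1_linearB linB (ls _) (ls _)); apply/funext => j;
      rewrite addSn /= !fctE /GRing.scale /=; ring.
  apply: le_trans (l1Z _ (bB _ lB).1).2 _; rewrite normrN normr1 mul1r.
  apply: le_trans (bB _ lB).2 _.
  by rewrite /e /= exprS mulrCA ler_wpM2l.
have e0 : e @ \oo --> 0 by apply: cvg_geometric; rewrite ger0_norm.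
have [y ly ye] := l1_complete ls se e0.
exists y => //.
have lBy := (bB _ ly).1.
apply/eqP; rewrite -subr_eq0; apply/eqP; apply: nrm_eq0.
  exact: (l1B (l1D ly lBy).1 lb).1.
apply/eqP; rewrite eq_le nrm_ge0 andbT.
have cv : e n.+1 + r * e n @[n --> \oo] --> 0 + r * 0.
  apply: cvgD; first by rewrite cvg_shiftS.
  by apply: cvgMl_tmp.
rewrite mulr0 addr0 in cv.
apply: (cvgr_to_ge cv); apply: nearW => n.
have -> : y + B y - b = (y - s n.+1) + B (y - s n).
  rewrite (l1_linearB linB ly (ls n)); apply/funext => j; rewrite /= !fctE;
    ring.
have [l1' n1] := ye n.+1; have [l2 n2] := ye n; have [l3 n3] := bB _ l2.
apply: le_trans (l1D l1' l3).2 _; rewrite lerD //.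
by apply: le_trans n3 _; rewrite ler_wpM2l.
Qed.

End L1ops.

(** * Alternating series and finite vectors *)

Section AltSum.
Context {R : realType}.
Implicit Types (y z : nat -> R) (C : R).

Definition altsum m y : R := limn (fun n => \sum_(m <= l < n) (-1) ^+ l * y l).

Lemma altsum_cvg m y C : (forall n, \sum_(m <= l < n) `|y l| <= C) ->
  cvgn (fun n => \sum_(m <= l < n) (-1) ^+ l * y l).
Proof.
move=> yC.
rewrite (is_cvg_series_restrict m (fun l => (-1) ^+ l * y l)).
apply: normed_cvg.
rewrite -(is_cvg_series_restrict m) /=.
have yE n : \sum_(m <= l < n) `|(-1) ^+ l * y l| = \sum_(m <= l < n) `|y l|.
  by apply: eq_bigr => l _; rewrite normrM normrX normrN1 expr1n mul1r.
under eq_fun do rewrite yE.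
apply: nondecreasing_is_cvgn; first by apply: nondecreasing_series.
by exists C => _ [n _ <-].
Qed.

Lemma altsum_bound m y C : (forall n, \sum_(m <= l < n) `|y l| <= C) ->
  `|altsum m y| <= C.
Proof.
move=> yC; rewrite /altsum -lim_norm; last exact: altsum_cvg yC.
apply: limr_le; first exact: is_cvg_norm (altsum_cvg yC).
apply: nearW => n.
apply: le_trans (yC n); apply: le_trans (ler_norm_sum _ _ _) _.
by apply: ler_sum => l _; rewrite normrM normrX normrN1 expr1n mul1r.
Qed.

Lemma altsum_linear m a y z C D : (forall n, \sum_(m <= l < n) `|y l| <= C) ->
  (forall n, \sum_(m <= l < n) `|z l| <= D) ->
  altsum m (a *: y + z) = a * altsum m y + altsum m z.
Proof.
move=> yC zD; apply/cvg_lim => //.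
have -> : (fun n => \sum_(m <= l < n) (-1) ^+ l * (a *: y + z) l) =
  (fun n => a * \sum_(m <= l < n) (-1) ^+ l * y l
            + \sum_(m <= l < n) (-1) ^+ l * z l).
  apply/funext => n; rewrite mulr_sumr -big_split /=; apply: eq_bigr => l _.
  by rewrite !fctE /GRing.scale /=; ring.
apply: cvgD; last exact: altsum_cvg zD.
by apply: cvgMl_tmp; exact: altsum_cvg yC.
Qed.

Lemma altsum_split k m y C : (k <= m)%N ->
  (forall n, \sum_(m <= l < n) `|y l| <= C) ->
  altsum k y = \sum_(k <= l < m) (-1) ^+ l * y l + altsum m y.
Proof.
move=> km yC; apply/cvg_lim => //.
apply: (@cvg_trans _ ((fun n => \sum_(k <= l < m) (-1) ^+ l * y l
                                + \sum_(m <= l < n) (-1) ^+ l * y l) @ \oo)).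
  by apply: near_eq_cvg; exists m => // n /= mn; rewrite -big_cat_nat.
by apply: cvgD; [exact: cvg_cst|exact: altsum_cvg yC].
Qed.

Lemma sum_delta (V : pzRingType) (F : nat -> V) m n a :
  \sum_(m <= l < n) F l * (l == a)%:R = if (m <= a < n)%N then F a else 0.
Proof.
elim: n => [|n IH]; first by rewrite big_geq // ltn0 andbF.
have [mn|nm] := leqP m n; last first.
  by rewrite big_geq //; case: ifP => //; lia.
rewrite big_nat_recr //= IH ltnS.
case: (ltngtP a n) => [an|na|->].
- by rewrite mulr0 addr0.
- by rewrite mulr0 addr0.
- by rewrite mulr1 andbF add0r mn.
Qed.

Lemma altsum_delta m a (F : nat -> R) :
  altsum m (fun l => F l * (l == a)%:R) =
  if (m <= a)%N then (-1) ^+ a * F a else 0.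
Proof.
apply/cvg_lim => //; apply: (@cvg_near_cst _ _ _ _ \oo).
exists a.+1 => // n /= an.
under eq_bigr do rewrite mulrA.
by rewrite (sum_delta (fun l => (-1) ^+ l * F l)) an andbT.
Qed.

Lemma l1_tail m n y : l1 y -> (0 < m)%N ->
  \sum_(m <= l < n) `|y l| <= (nrm y - psum m y) / 2.
Proof.
move=> ly m0; rewrite ler_pdivlMr //.
have [nm|mn] := leqP n m.
  by rewrite big_geq // mul0r subr_ge0; exact: psum_le_nrm.
rewrite lerBrDl mulrC; apply: le_trans (psum_le_nrm n ly).
rewrite (psum_cat _ (ltnW mn)) lerD2l mulr_sumr.
rewrite le_eqVlt; apply/orP; left; apply/eqP.
by apply: eq_big_nat => -[|l] //; lia.
Qed.

End AltSum.

Section Vnorm.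
Context {R : realType} {N : nat}.
Implicit Types (x v : 'cV[R]_N.+1) (M : 'M[R]_N.+1).

Lemma vnormE x : vnorm x = \sum_(j < N.+1) weight j * `|x j 0|.
Proof.
rewrite (bigD1 ord0) //= mul1r /vnorm mulr_sumr; congr (_ + _).
by apply: eq_big => [[[|j] Hj]|[[|j] Hj]].
Qed.

Lemma vnorm_ge0 x : 0 <= vnorm x.
Proof.
by rewrite vnormE sumr_ge0 // => j _; rewrite mulr_ge0 // ltW // weight_gt0.
Qed.

Lemma vnormD x v : vnorm (x + v) <= vnorm x + vnorm v.
Proof.
rewrite !vnormE -big_split /=; apply: ler_sum => j _; rewrite -mulrDr mxE.
by rewrite ler_wpM2l ?ler_normD // ltW // weight_gt0.
Qed.

Lemma vnormZ (a : R) x : vnorm (a *: x) = `|a| * vnorm x.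
Proof.
by rewrite !vnormE mulr_sumr; apply: eq_bigr => j _; rewrite mxE normrM; ring.
Qed.

Lemma vnorm_coord x j : `|x j 0| <= vnorm x.
Proof.
rewrite vnormE (bigD1 j) //= -[leLHS]addr0 lerD //.
  by rewrite ler_peMl // weight_ge1.
by rewrite sumr_ge0 // => k _; rewrite mulr_ge0 // ltW // weight_gt0.
Qed.

Lemma vnorm_sum (I : finType) (F : I -> 'cV[R]_N.+1) :
  vnorm (\sum_i F i) <= \sum_i vnorm (F i).
Proof.
elim/big_ind2: _ => //.
  by rewrite vnormE big1 // => j _; rewrite mxE normr0 mulr0.
by move=> a b c d h1 h2; apply: le_trans (vnormD _ _) _; exact: lerD.
Qed.

Lemma vnorm_mulmx_columns M x :
  vnorm (M *m x) <= (\sum_j vnorm (col j M)) * vnorm x.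
Proof.
have -> : M *m x = \sum_j x j 0 *: col j M.
  apply/matrixP => i k; rewrite (ord1 k) mxE summxE; apply: eq_bigr => j _.
  by rewrite !mxE mulrC.
apply: le_trans (vnorm_sum _) _; rewrite mulr_suml; apply: ler_sum => j _.
by rewrite vnormZ mulrC ler_wpM2l ?vnorm_ge0 ?vnorm_coord.
Qed.

(** [mx_opnorm] is a supremum of reals, meaningful only for a bounded set; the
    sum of the column norms provides the bound, and scaling does the rest. *)
Lemma vnorm_mulmx_opnorm M x : vnorm (M *m x) <= mx_opnorm M * vnorm x.
Proof.
have [x0|x0] := eqVneq (vnorm x) 0.
  by apply: le_trans (vnorm_mulmx_columns _ _) _; rewrite x0 !mulr0.
have xp : 0 < vnorm x by rewrite lt_neqAle eq_sym x0 vnorm_ge0.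
rewrite -ler_pdivrMr // mulrC.
rewrite -[(vnorm x)^-1]ger0_norm ?invr_ge0 ?vnorm_ge0 // -vnormZ.
apply: ub_le_sup.
  exists (\sum_j vnorm (col j M)) => _ [v /= v1 <-].
  apply: le_trans (vnorm_mulmx_columns _ _) _.
  by rewrite ler_piMr // sumr_ge0 // => j _; exact: vnorm_ge0.
exists ((vnorm x)^-1 *: x); last by rewrite scalemxAr.
by rewrite /= vnormZ ger0_norm ?invr_ge0 ?vnorm_ge0 // mulVf.
Qed.

End Vnorm.

(** * The approximate inverse and the coupling *)

Section Approx.
Context {R : realType}.
Variables (mu : R) (N : nat).
Implicit Types (y z r : nat -> R) (v : 'cV[R]_N.+1) (a C D : R).

Definition headv y : 'cV[R]_N.+1 := \col_i y i.

Definition glue v y : nat -> R :=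
  fun j => if (j <= N)%N then v (inord j) 0 else y j.

(** Solves the diagonal rows [2 l y_l = r_l].  At [l = 0] this divides by
    zero; [glue] keeps only the indices above [N]. *)
Definition diag_inv r : nat -> R := fun l => r l / (2 * l%:R).

(** The inverse of the block triangular part of [Lop mu]. *)
Definition approx_inv r : nat -> R :=
  glue (invmx (Ltrunc mu N) *m headv r
        - (2 * altsum N.+1 (diag_inv r)) *: c_first mu N)
       (diag_inv r).

(** The entries of [Lop mu] outside its block triangular part. *)
Definition coupling y : nat -> R := fun j =>
  (if (N < j)%N then mu * y j.-1 else 0)
  - (if (N <= j)%N then mu * y j.+1 else 0).

Lemma psum_head y : psum N.+1 y = vnorm (headv y).
Proof.
by rewrite vnormE /psum big_mkord; apply: eq_bigr => j _; rewrite mxE.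
Qed.

Lemma headv_glue v y : headv (glue v y) = v.
Proof.
apply/matrixP => i k.
by rewrite (ord1 k) mxE /glue -ltnS ltn_ord inord_val.
Qed.

Lemma nrm_glue v y C : (forall n, \sum_(N.+1 <= l < n) `|y l| <= C) ->
  l1 (glue v y) /\ nrm (glue v y) <= vnorm v + 2 * C.
Proof.
move=> yC; apply: l1_of_psum_le => n.
apply: le_trans (psum_nd _ (leq_addl N.+1 n)) _.
rewrite (psum_cat _ (leq_addr n N.+1)) psum_head headv_glue lerD2l.
apply: le_trans (_ : 2 * \sum_(N.+1 <= l < N.+1 + n) `|y l| <= _).
  rewrite mulr_sumr le_eqVlt; apply/orP; left; apply/eqP.
  by apply: eq_big_nat => -[|l] // /andP[Nl _]; rewrite /glue leqNgt Nl.
by rewrite ler_pM2l.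
Qed.

Lemma diag_inv_linear a y z :
  diag_inv (a *: y + z) = a *: diag_inv y + diag_inv z.
Proof.
by apply/funext => j; rewrite /diag_inv !fctE /GRing.scale /= mulrDl mulrA.
Qed.

(** Dividing by [2 l >= 2 (N+1)], and halving because the norm counts the
    entries of the tail twice. *)
Lemma diag_inv_tail y n : l1 y ->
  \sum_(N.+1 <= l < n) `|diag_inv y l| <= (nrm y - psum N.+1 y) / (4 * N.+1%:R).
Proof.
move=> ly.
apply: le_trans (_ : (2 * N.+1%:R)^-1 * \sum_(N.+1 <= l < n) `|y l| <= _).
  rewrite mulr_sumr; apply: ler_sum_nat => l /andP[Nl _].
  rewrite /diag_inv normrM mulrC ler_wpM2r // normfV ger0_norm //.
  rewrite lef_pV2 ?ler_pM2l ?ler_nat // posrE mulr_gt0 // ltr0n; lia.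
have N0 : (0 : R) < N.+1%:R by rewrite ltr0n.
apply: le_trans (_ : (2 * N.+1%:R)^-1 * ((nrm y - psum N.+1 y) / 2) <= _).
  by rewrite ler_pM2l ?invr_gt0 ?mulr_gt0 //; exact: l1_tail.
rewrite le_eqVlt; apply/orP; left; apply/eqP; field; lra.
Qed.

(** With [q] the norm of the tail of [y], the head of the image costs
    [|M| |head y| + q |c_1| / (2 (N+1))] and its tail [q / (2 (N+1))]: the two
    terms of the maximum [beta] are the factors in front of [|head y|] and [q]. *)
Lemma approx_inv_bounded : l1_bounded (beta mu N) approx_inv.
Proof.
move=> y ly; have ht n := diag_inv_tail n ly.
have [lA nA] := nrm_glue
  (invmx (Ltrunc mu N) *m headv y
   - (2 * altsum N.+1 (diag_inv y)) *: c_first mu N) ht.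
split=> //; apply: le_trans nA _.
set q := nrm y - psum N.+1 y in ht *.
have q0 : 0 <= q by rewrite subr_ge0 psum_le_nrm.
have N0 : (0 : R) < N.+1%:R by rewrite ltr0n.
set c := vnorm (c_first mu N).
have c0 : 0 <= c by exact: vnorm_ge0.
have S1 : `|2 * altsum N.+1 (diag_inv y)| <= q / (2 * N.+1%:R).
  rewrite normrM ger0_norm //.
  have -> : q / (2 * N.+1%:R) = 2 * (q / (4 * N.+1%:R)) by field; lra.
  by rewrite ler_pM2l // altsum_bound.
have V1 : vnorm (invmx (Ltrunc mu N) *m headv y
                 - (2 * altsum N.+1 (diag_inv y)) *: c_first mu N)
   <= mx_opnorm (invmx (Ltrunc mu N)) * psum N.+1 y + q / (2 * N.+1%:R) * c.
  apply: le_trans (vnormD _ _) _; rewrite -scaleNr vnormZ normrN psum_head.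
  by rewrite lerD ?vnorm_mulmx_opnorm // ler_wpM2r.
have b1 : mx_opnorm (invmx (Ltrunc mu N)) <= beta mu N.
  by rewrite /beta le_max lexx.
have b2 : (2 * N.+1%:R)^-1 * (c + 1) <= beta mu N.
  by rewrite /beta le_max lexx orbT.
have -> : nrm y = psum N.+1 y + q by rewrite /q addrC subrK.
rewrite mulrDr; apply: le_trans (lerD V1 (lexx _)) _; rewrite -addrA.
apply: lerD; first by apply: ler_wpM2r b1; exact: psum_ge0.
apply: le_trans (ler_wpM2r q0 b2).
by rewrite le_eqVlt; apply/orP; left; apply/eqP; field; lra.
Qed.

Lemma headv_linear a y z : headv (a *: y + z) = a *: headv y + headv z.
Proof. by apply/matrixP => i j; rewrite !mxE. Qed.

Lemma approx_inv_linear : l1_linear approx_inv.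
Proof.
move=> a y z ly lz; rewrite /approx_inv diag_inv_linear headv_linear.
rewrite (altsum_linear a (fun n => diag_inv_tail n ly)
                         (fun n => diag_inv_tail n lz)).
apply/funext => j; rewrite /glue !fctE; case: ifP => // _.
rewrite mulmxDr -scalemxAr !mxE /GRing.scale /=; ring.
Qed.

Lemma coupling_linear a y z :
  coupling (a *: y + z) = a *: coupling y + coupling z.
Proof.
apply/funext => j; rewrite /coupling !fctE /GRing.scale /=.
by case: ifP; case: ifP => _ _; ring.
Qed.

Lemma coupling_bounded : l1_bounded (4 * `|mu|) coupling.
Proof.
move=> y ly; apply: l1_of_psum_le => n.
have s1 m : \sum_(0 <= l < m) `|y l| <= nrm y.
  apply: le_trans (psum_le_nrm m ly); apply: ler_sum => l _.
  by rewrite ler_peMl // weight_ge1.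
apply: le_trans (_ : 2 * `|mu| *
    (\sum_(0 <= j < n) `|if (N < j)%N then y j.-1 else 0|
     + \sum_(0 <= j < n) `|y j.+1|) <= _).
  rewrite -big_split mulr_sumr; apply: ler_sum => j _ /=.
  rewrite -mulrA; apply: ler_pM => //.
  - exact: ltW (weight_gt0 _).
  - by case: j => //=; rewrite ler1n.
  rewrite /coupling; apply: le_trans (ler_normB _ _) _; rewrite mulrDr -!normrM.
  rewrite lerD //; first by case: ifP; rewrite ?mulr0.
  by case: ifP => // _; rewrite normr0.
have h2 : \sum_(0 <= j < n) `|y j.+1| <= nrm y.
  by apply: le_trans (s1 n.+1); rewrite [leRHS]big_nat_recl //= lerDr.
have h1 : \sum_(0 <= j < n) `|if (N < j)%N then y j.-1 else 0| <= nrm y.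
  case: n h2 => [_|n _]; first by rewrite big_geq // nrm_ge0.
  rewrite big_nat_recl //= normr0 add0r; apply: le_trans (s1 n).
  by apply: ler_sum => j _; case: ifP => // _; rewrite normr0.
have -> : 4 * `|mu| * nrm y = 2 * `|mu| * (nrm y + nrm y) by ring.
by rewrite ler_wpM2l ?mulr_ge0 // lerD.
Qed.

Lemma c_firstE : c_first mu N = invmx (Ltrunc mu N) *m delta_mx ord0 0.
Proof. exact: colE. Qed.

(** In the rows of the head, the entries beyond column [N] are those of row 0,
    which sum to the alternating series, and the entry [-mu] of row [N], which
    belongs to the coupling. *)
Lemma Lop_head y (i : 'I_N.+1) : (0 < N)%N -> l1 y ->
  Lop mu y i =
    (Ltrunc mu N *m headv y + (2 * altsum N.+1 y) *: delta_mx ord0 0) i 0 +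
    coupling y i.
Proof.
move=> N_gt0 ly; rewrite !mxE.
have lt n := l1_tail n ly (ltn0Sn N).
case: i => -[|j] Hj /=.
  rewrite /coupling /= leqNgt N_gt0 /= subrr addr0 mulr1 -/(altsum 1 y).
  rewrite (altsum_split (ltn0Sn N) lt) mulrDr addrA; congr (_ + _).
  rewrite big_ord_recl !mxE Lop_unit_seq0 /= mul1r; congr (_ + _).
  rewrite big_add1 /= big_mkord mulr_sumr; apply: eq_bigr => l _.
  by rewrite !mxE Lop_unit_seq0 /= mulrA.
rewrite mulr0 addr0.
have pk (a : nat) :
  \sum_(l < N.+1) y l * (a == l)%:R = if (a < N.+1)%N then y a else 0.
  rewrite -(big_mkord xpredT (fun l => y l * (a == l)%:R)).
  by under eq_bigr do rewrite eq_sym; rewrite sum_delta.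
have -> : \sum_(l < N.+1) (Ltrunc mu N) (Ordinal Hj) l * headv y l 0 =
   mu * (\sum_(l < N.+1) y l * (j == l)%:R)
   + 2 * j.+1%:R * (\sum_(l < N.+1) y l * (j.+1 == l)%:R)
   - mu * (\sum_(l < N.+1) y l * (j.+2 == l)%:R).
  rewrite !mulr_sumr -big_split -sumrB; apply: eq_bigr => l _.
  by rewrite !mxE /= /unit_seq; ring.
rewrite !pk Hj (ltnW Hj) /coupling.
rewrite (_ : (N < j.+1)%N = false); last by lia.
rewrite [(j.+2 < N.+1)%N]ltnS ltnNge.
by case: (N <= j.+1)%N => /=; ring.
Qed.

Lemma Lop_tail y j : (N < j)%N -> Lop mu y j = 2 * j%:R * y j + coupling y j.
Proof. by case: j => // j Nj; rewrite /coupling Nj (ltnW Nj) /=; ring. Qed.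

(** In both directions the tail of [y] is the solution of the diagonal rows, so
    that [y] and [diag_inv (z - coupling mu N y)] have the same alternating tail
    sum, and the rows of the head become a finite linear system. *)
Lemma Lop_fixed_point y z : (0 < N)%N -> Ltrunc mu N \in unitmx -> l1 y ->
  Lop mu y = z <-> y = approx_inv (z - coupling y).
Proof.
move=> N_gt0 L_inv ly; split=> [Lz|yA].
  have tl j : (N < j)%N -> y j = diag_inv (z - coupling y) j.
    move=> Nj; rewrite -Lz /diag_inv !fctE Lop_tail // addrK.
    have j0 : (0 : R) < j%:R by rewrite ltr0n; lia.
    by rewrite [2 * _ * _]mulrC mulfK // gt_eqF // mulr_gt0.
  have aE : altsum N.+1 (diag_inv (z - coupling y)) = altsum N.+1 y.
    rewrite /altsum; congr (limn _); apply/funext => n;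
      apply: eq_big_nat => l /andP[Nl _].
    by rewrite tl.
  have hE : headv (z - coupling y) =
    Ltrunc mu N *m headv y + (2 * altsum N.+1 y) *: delta_mx ord0 0.
    by apply/matrixP => i k; rewrite (ord1 k) mxE -Lz !fctE Lop_head // addrK.
  apply/funext => j; rewrite /approx_inv /glue; case: leqP => [jN|];
    last exact: tl.
  rewrite aE hE mulmxDr mulKmx // -scalemxAr c_firstE addrK mxE inordK //.
have hy := headv_glue
  (invmx (Ltrunc mu N) *m headv (z - coupling y)
   - (2 * altsum N.+1 (diag_inv (z - coupling y))) *: c_first mu N)
  (diag_inv (z - coupling y)).
rewrite -/(approx_inv _) -yA in hy.
have tl j : (N < j)%N -> y j = diag_inv (z - coupling y) j.
  by move=> Nj; rewrite {1}yA /approx_inv /glue leqNgt Nj.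
have aE : altsum N.+1 (diag_inv (z - coupling y)) = altsum N.+1 y.
  rewrite /altsum; congr (limn _); apply/funext => n;
    apply: eq_big_nat => l /andP[Nl _].
  by rewrite tl.
apply/funext => j; case: (leqP j N) => [jN|Nj].
  rewrite -ltnS in jN;
    rewrite (Lop_head (Ordinal jN)) // hy aE mulmxBr mulKVmx //.
  by rewrite c_firstE -scalemxAr mulKVmx // subrK mxE /= !fctE subrK.
have j0 : (0 : R) < j%:R by rewrite ltr0n; lia.
by rewrite Lop_tail // tl // /diag_inv [2 * _ * _]mulrC mulfVK ?subrK //
  gt_eqF // mulr_gt0.
Qed.

End Approx.

(** * Columns of the correction *)

Section Columns.
Context {R : realType}.
Variables (mu : R) (N : nat).
Implicit Types (y z r : nat -> R).
Local Notation e_ := (@unit_seq R).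
Local Notation M := (invmx (Ltrunc mu N)).
Local Notation c1 := (c_first mu N).

Definition tail_inv (j : nat) : R := if (N < j)%N then j%:R^-1 else 0.

Lemma tail_inv_ge0 j : 0 <= tail_inv j.
Proof. by rewrite /tail_inv; case: ifP => // _; rewrite invr_ge0. Qed.

Lemma diag_inv_unit j : diag_inv (e_ j) = fun l => (2 * l%:R)^-1 * (l == j)%:R.
Proof. by apply/funext => l; rewrite /diag_inv /unit_seq mulrC. Qed.

Lemma altsum_unit j :
  2 * altsum N.+1 (diag_inv (e_ j)) = (-1) ^+ j * tail_inv j.
Proof.
rewrite diag_inv_unit altsum_delta /tail_inv; case: ifP => Nj;
  rewrite ?mulr0 //.
have j0 : (0 : R) < j%:R by rewrite ltr0n; lia.
field; lra.
Qed.

Lemma diag_inv_unit_tail j n :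
  \sum_(N.+1 <= l < n) `|diag_inv (e_ j) l| <= tail_inv j / 2.
Proof.
have -> : \sum_(N.+1 <= l < n) `|diag_inv (e_ j) l| =
          \sum_(N.+1 <= l < n) (2 * l%:R)^-1 * (l == j)%:R.
  by apply: eq_bigr => l _;
    rewrite diag_inv_unit ger0_norm // mulr_ge0 // invr_ge0 mulr_ge0.
rewrite sum_delta /tail_inv; case: (ltnP N j) => /= Nj; last by rewrite mul0r.
case: ifP => _; last by rewrite divr_ge0 // invr_ge0.
by rewrite invfM mulrC.
Qed.

(** Except at [N], every nonzero column of the coupling is a multiple of a
    difference of unit sequences; the contributions of its two entries to row 0
    partly cancel, and have to be added before norms are taken. *)
Lemma nrm_approx_inv_unitB i j :
  nrm (approx_inv mu N (e_ i - e_ j)) <=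
    vnorm (M *m headv N (e_ i - e_ j)
           - ((-1) ^+ i * tail_inv i - (-1) ^+ j * tail_inv j) *: c1)
    + (tail_inv i + tail_inv j).
Proof.
have hB : diag_inv (e_ i - e_ j) = -1 *: diag_inv (e_ j) + diag_inv (e_ i).
  by rewrite -diag_inv_linear addrC scaleN1r.
rewrite /approx_inv hB (altsum_linear (-1) (diag_inv_unit_tail j)
  (diag_inv_unit_tail i)).
have -> : 2 * (-1 * altsum N.+1 (diag_inv (e_ j))
               + altsum N.+1 (diag_inv (e_ i))) =
          (-1) ^+ i * tail_inv i - (-1) ^+ j * tail_inv j.
  by rewrite -!altsum_unit; ring.
have -> : tail_inv i + tail_inv j = 2 * (tail_inv j / 2 + tail_inv i / 2).
  by field.
apply: (nrm_glue _ _).2 => n.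
apply: le_trans (lerD (diag_inv_unit_tail j n) (diag_inv_unit_tail i n)).
rewrite -big_split; apply: ler_sum => l _ /=.
rewrite !fctE scaleN1r; apply: le_trans (ler_normD _ _) _; by rewrite normrN.
Qed.

Lemma headv_unit_tail j : (N < j)%N -> headv N (e_ j) = 0.
Proof.
move=> Nj; apply/matrixP => i k; rewrite !mxE /unit_seq ltn_eqF //.
exact: leq_trans (ltn_ord i) _.
Qed.

Lemma headv_unit_last : headv N (e_ N) = delta_mx ord_max 0.
Proof. by apply/matrixP => i k; rewrite (ord1 k) !mxE /unit_seq andbT. Qed.

Lemma headvB y z : headv N (y - z) = headv N y - headv N z.
Proof. by apply/matrixP => i j; rewrite !mxE. Qed.

Lemma coupling_unit_low j : (j < N)%N -> coupling mu N (e_ j) = 0.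
Proof.
move=> jN; apply/funext => i; rewrite /coupling /unit_seq.
have e1 : (N < i)%N -> (i.-1 == j) = false by lia.
have e2 : (N <= i)%N -> (i.+1 == j) = false by lia.
by case: ifP => [/e1 ->|_]; case: ifP => [/e2 ->|_]; rewrite ?mulr0 subrr.
Qed.

Lemma coupling_unit_N : coupling mu N (e_ N) = mu *: e_ N.+1.
Proof.
apply/funext => i; rewrite /coupling /unit_seq !fctE /GRing.scale /=.
have e2 : (N <= i)%N -> (i.+1 == N) = false by lia.
have -> : (if (N <= i)%N then mu * (i.+1 == N)%:R else 0) = 0.
  by case: ifP => // /e2 ->; rewrite mulr0.
rewrite subr0; case: ifP => h; first by case: i h {e2} => //= i _; rewrite eqSS.
by have -> : (i == N.+1) = false; [lia|rewrite mulr0].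
Qed.

Lemma coupling_unit_high j : (N < j)%N ->
  coupling mu N (e_ j) = mu *: (e_ j.+1 - e_ j.-1).
Proof.
move=> Nj; apply/funext => i;
  rewrite /coupling /unit_seq !fctE /GRing.scale /= mulrBr.
congr (_ - _).
  case: ifP => h; first by case: i h => //= i _; rewrite eqSS.
  by have -> : (i == j.+1) = false; [lia|rewrite mulr0].
case: ifP => h; first by case: j Nj => //= j _; rewrite eqSS.
by have -> : (i == j.-1) = false; [lia|rewrite mulr0].
Qed.

Lemma le_rho_half (q : R) :
  (q <= rho1 mu N) || (q <= rho2 mu N) || (q <= rho3 mu N) ->
  `|mu| * q <= rho mu N * 2.
Proof.
move=> h; have -> : rho mu N * 2 =
  `|mu| * Num.max (rho1 mu N) (Num.max (rho2 mu N) (rho3 mu N)).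
  by rewrite /rho; field.
by rewrite ler_wpM2l // !le_max orbA.
Qed.

Lemma rho_ge0 : 0 <= rho mu N.
Proof.
rewrite -(pmulr_lge0 _ (ltr0n R 2));
  apply: le_trans (le_rho_half (q := rho1 mu N) _).
  by rewrite mulr_ge0 // /rho1 mulr_ge0 ?invr_ge0 // addr_ge0 // vnorm_ge0.
by rewrite lexx.
Qed.

(** Column [N] gives [rho1] and column [N+1] gives [rho2], where the sign in
    front of [c_first] uses that [N] is even.  In column [j >= N+2] the two
    contributions to row 0 have the same parity and opposite signs, so
    [1/(j-1) - 1/(j+1) = 2/((j-1)(j+1))] appears; this and the tail decrease in
    [j], and [j = N+2] gives [rho3]. *)
Lemma correction_column j : (0 < N)%N -> ~~ odd N ->
  nrm (approx_inv mu N (coupling mu N (e_ j))) <= rho mu N * weight j.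
Proof.
move=> N_gt0 N_even.
have lA y : l1 y -> l1 (approx_inv mu N y).
  by move=> ly; case: (@approx_inv_bounded R mu N y ly).
have AZ y : l1 y ->
  nrm (approx_inv mu N (mu *: y)) <= `|mu| * nrm (approx_inv mu N y).
  move=> ly; rewrite -[mu *: y]addr0 approx_inv_linear //; last exact: l1_0.1.
  rewrite (l1_linear0 (@approx_inv_linear _ mu N)) addr0;
    exact: (l1Z _ (lA _ ly)).2.
have lu i : l1 (e_ i) by exact: (l1_unit i).1.
have [jN|Nj] := ltnP j N.
  rewrite coupling_unit_low // (l1_linear0 (@approx_inv_linear _ mu N)) l1_0.2.
  by rewrite mulr_ge0 ?rho_ge0 // ltW // weight_gt0.
have -> : weight j = 2 :> R by case: j Nj => //; lia.
have step i k : nrm (approx_inv mu N (mu *: (e_ i - e_ k))) <= `|mu| *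
  (vnorm (M *m headv N (e_ i - e_ k)
          - ((-1) ^+ i * tail_inv i - (-1) ^+ k * tail_inv k) *: c1)
    + (tail_inv i + tail_inv k)).
  apply: le_trans (AZ _ (l1B (lu _) (lu _)).1) _.
  by rewrite ler_wpM2l // nrm_approx_inv_unitB.
have N1 : (0 : R) < N.+1%:R by rewrite ltr0n.
have [jN|Nj'] := eqVneq j N.
  rewrite jN coupling_unit_N; apply: le_trans (AZ _ (lu _)) _;
    apply: le_rho_half.
  apply/orP; left; apply/orP; left.
  rewrite /approx_inv headv_unit_tail // mulmx0 add0r altsum_unit.
  apply: le_trans (nrm_glue _ (diag_inv_unit_tail N.+1)).2 _.
  rewrite -scaleNr vnormZ normrN normrM normrX normrN1 expr1n mul1r.
  rewrite ger0_norm ?tail_inv_ge0 //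
    /tail_inv ltnSn /rho1 [leRHS]mulrDr mulr1 lerD2l.
  by rewrite mulrC divfK.
rewrite coupling_unit_high; last by lia.
apply: le_trans (step _ _) _; apply: le_rho_half.
have [jN|Nj2] := eqVneq j N.+1.
  apply/orP; left; apply/orP; right.
  rewrite jN /= headvB headv_unit_tail // headv_unit_last sub0r mulmxN.
  have -> : tail_inv N = 0 by rewrite /tail_inv ltnn.
  have -> : tail_inv N.+2 = N.+2%:R^-1 by rewrite /tail_inv leqW.
  have -> : (-1) ^+ N.+2 = 1 :> R.
    by rewrite -signr_odd /= negbK (negbTE N_even).
  rewrite mulr0 subr0 mul1r addr0 /rho2 -colE -opprD -scaleN1r vnormZ normrN
    normr1 mul1r.
  by rewrite lexx.
apply/orP; right.
case: j Nj Nj' Nj2 => [|j] Nj Nj' Nj2; first by lia.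
have Nj3 : (N < j)%N by lia.
rewrite /= headvB !headv_unit_tail ?subr0 ?mulmx0 ?add0r; [|lia..].
rewrite /tail_inv Nj3 (_ : (N < j.+2)%N = true); last by lia.
rewrite -scaleNr vnormZ normrN !exprS mulN1r mulN1r opprK -mulrBr normrM normrX
  normrN1 expr1n mul1r.
have j1 : (0 : R) < j%:R by rewrite ltr0n; lia.
have j2 : (0 : R) < j.+2%:R by rewrite ltr0n.
have N3 : (0 : R) < N.+3%:R by rewrite ltr0n.
have l1' : j%:R^-1 <= N.+1%:R^-1 :> R by rewrite lef_pV2 ?posrE // ler_nat.
have l2' : j.+2%:R^-1 <= N.+3%:R^-1 :> R.
  by rewrite lef_pV2 ?posrE // ler_nat; lia.
have eq2 (k : nat) : (0 : R) < k%:R ->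
  k%:R^-1 - k.+2%:R^-1 = 2 * (k%:R^-1 * k.+2%:R^-1) :> R.
  by move=> k0; rewrite -addn2 natrD; field; lra.
rewrite distrC ger0_norm; last by rewrite subr_ge0 lef_pV2 ?posrE // ler_nat;
  lia.
rewrite /rho3 eq2 // invfM -addrA lerD //; last by rewrite addrC lerD.
rewrite ler_wpM2r ?vnorm_ge0 // ler_pM2l // ler_pM // ?invr_ge0 //.
Qed.

End Columns.

Theorem lemma3p2 (R : realType) (mu : R) (N : nat)
    (N_ge2 : (2 <= N)%N) (N_even : ~~ odd N)
    (L_inv : Ltrunc mu N \in unitmx)
    (rho_lt1 : rho mu N < 1) :
  boundedly_invertible (Lop mu) /\
  (l1_opnorm (l1_inv (Lop mu)) <= (beta mu N / (1 - rho mu N))%:E)%E.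
Proof.
have N_gt0 : (0 < N)%N by exact: ltnW.
have r0 : 0 < 1 - rho mu N by rewrite subr_gt0.
have linA := @approx_inv_linear R mu N; have bA := @approx_inv_bounded R mu N.
have bK := @coupling_bounded R mu N.
pose T y := approx_inv mu N (coupling mu N y).
have beta0 : 0 <= beta mu N.
  have := (bA _ (l1_unit 0).1).2; rewrite (l1_unit 0).2 mulr1.
  by apply: le_trans; exact: nrm_ge0.
have linT : l1_linear T.
  by move=> a y z ly lz; rewrite /T coupling_linear linA //;
    [exact: (bK _ ly).1|exact: (bK _ lz).1].
(* A crude bound, needed only for the continuity of [T]. *)
have bT' : l1_bounded (beta mu N * (4 * `|mu|)) T.
  move=> y ly; have [lK nK] := bK _ ly; have [lT nT] := bA _ lK.
  by split=> //; apply: le_trans nT _; rewrite -mulrA ler_wpM2l.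
have bT : l1_bounded (rho mu N) T.
  by apply: l1_column_bound bT' _ => // j; exact: correction_column.
have eqT y z : l1 y -> l1 z -> Lop mu y = z <-> y + T y = approx_inv mu N z.
  move=> ly lz; rewrite (Lop_fixed_point z N_gt0 L_inv ly) l1_linearB //;
    last exact: (bK _ ly).1.
  by split=> [{1}->|<-]; rewrite ?subrK ?addrK.
have bnd y z : l1 y -> l1 z -> Lop mu y = z ->
  nrm y <= beta mu N / (1 - rho mu N) * nrm z.
  move=> ly lz /(eqT _ _ ly lz) h;
    apply: le_trans (neumann_bound bT rho_lt1 ly h) _.
  rewrite mulrAC ler_pM2r ?invr_gt0 //; exact: (bA _ lz).2.
have ex z : l1 z -> exists2 y, l1 y & Lop mu y = z.
  move=> lz; have [y ly h] :=
    neumann_exists linT bT (rho_ge0 mu N) rho_lt1 (bA _ lz).1.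
  by exists y => //; apply/eqT.
have inv z : l1 z -> l1 (l1_inv (Lop mu) z) /\ Lop mu (l1_inv (Lop mu) z) = z.
  move=> lz; rewrite /l1_inv; case: xgetP => [y -> //|no].
  by have [y ly h] := ex z lz; case: (no y).
have invb z : l1 z ->
  (l1norm (l1_inv (Lop mu) z) <= (beta mu N / (1 - rho mu N))%:E * l1norm z)%E.
  move=> lz; have [li ei] := inv z lz.
  by rewrite (l1_nrm li) (l1_nrm lz) -EFinM lee_fin; exact: bnd.
split; first split.
- move=> z lz; have [y ly h] := ex z lz; exists y; split=> // y' [ly' h'].
  apply/eqP; rewrite -subr_eq0; apply/eqP; apply: nrm_eq0.
    exact: (l1B ly ly').1.
  have hT : (y - y') + T (y - y') = 0.
    rewrite l1_linearB // addrACA -opprD.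
    by rewrite (eqT _ _ ly lz).1 // (eqT _ _ ly' lz).1 // subrr.
  have := neumann_bound bT rho_lt1 (l1B ly ly').1 hT.
  rewrite l1_0.2 mul0r => n0; apply/eqP; by rewrite eq_le n0 nrm_ge0.
- by exists (beta mu N / (1 - rho mu N)).
apply: ub_ereal_sup => _ [z /= z1 <-].
have lz : l1 z by apply: le_lt_trans z1 _; rewrite ltry.
apply: le_trans (invb z lz) _.
rewrite -[leRHS]mule1 lee_wpmul2l // lee_fin divr_ge0 // ltW //.
Qed.
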